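(* (a) For any FAQ query $Q$, $$\mathrm{smfw}(Q)\ \le\ \#\mathrm{smfw}(Q)\ \le\ \mathrm{faqw}(Q).$$ In particular, when $Q$ has no free variables, $\mathrm{subw}(Q)\le\#\mathrm{subw}(Q)\le\mathrm{fhtw}(Q)$. (b) There are classes of FAQ queries $Q$ for which the gap between $\#\mathrm{smfw}(Q)$ and $\mathrm{faqw}(Q)$ is unbounded, and likewise for the gap between $\#\mathrm{subw}(Q)$ and $\mathrm{fhtw}(Q)$; that is, for every real $c$ there is an FAQ query $Q$ with $\mathrm{faqw}(Q)-\#\mathrm{smfw}(Q)>c$, and for every real $c$ there is an FAQ query $Q$ without free variables with $\mathrm{fhtw}(Q)-\#\mathrm{subw}(Q)>c$.
   Context: For the purpose of these width parameters, an FAQ query $Q$ is determined by a finite multi-hypergraph $\mathcal H=(\mathcal V=[n],\mathcal E)$ ($\mathcal E$ a multiset of subsets of $\mathcal V$), a partition $\mathcal E=\mathcal E_{\not\infty}\cup\mathcal E_\infty$ (edges whose input factors have finite, respectively infinite, support) with $\bigcup_{S\in\mathcal E_{\not\infty}}S=\mathcal V$, and a set $F\subseteq\mathcal V$ of free variables. A tree decomposition of $\mathcal H$ is a pair $(T,\chi)$ with $T$ a tree and $\chi:V(T)\to2^{\mathcal V}$ such that every $S\in\mathcal E$ is contained in some bag $\chi(t)$ and, for each $v\in\mathcal V$, $\{t:v\in\chi(t)\}$ is a non-empty connected subtree. It is $F$-connex if there is a (possibly empty) $V'\subseteq V(T)$ forming a connected subtree with $\bigcup_{t\in V'}\chi(t)=F$.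 $\mathrm{TD}_F$ is the set of $F$-connex tree decompositions of $\mathcal H$. $\Gamma_n$ is the set of polymatroids on $\mathcal V=[n]$: monotone submodular $h:2^{\mathcal V}\to\mathbb R_+$ with $h(\emptyset)=0$. $\Gamma_{n|\mathcal E_{\not\infty}}$ is the set of $\mathcal E_{\not\infty}$-polymatroids: functions $h:2^{\mathcal V}\to\mathbb R_+$ with (i) $h(\emptyset)=0$; (ii) $h(X)\le h(Y)$ whenever $X\subseteq Y$; (iii) $h(X\cup Y)+h(X\cap Y)\le h(X)+h(Y)$ for every pair $X,Y\subseteq\mathcal V$ such that $X\cap Y\subseteq S$ for some $S\in\mathcal E_{\not\infty}$. Let $\mathrm{ED}_{\not\infty}=\{h:2^{\mathcal V}\to\mathbb R_+ : h(S)\le1\ \forall S\in\mathcal E_{\not\infty}\}$. Define $$\mathrm{faqw}(Q)=\min_{(T,\chi)\in\mathrm{TD}_F}\ \max_{h\in\mathrm{ED}_{\not\infty}\cap\Gamma_n}\ \max_{t\in V(T)}h(\chi(t)),$$ $$\mathrm{smfw}(Q)=\max_{h\in\mathrm{ED}_{\not\infty}\cap\Gamma_n}\ \min_{(T,\chi)\in\mathrm{TD}_F}\ \max_{t\in V(T)}h(\chi(t)),$$ $$\#\mathrm{smfw}(Q)=\max_{h\in\mathrm{ED}_{\not\infty}\cap\Gamma_{n|\mathcal E_{\not\infty}}}\ \min_{(T,\chi)\in\mathrm{TD}_F}\ \max_{t\in V(T)}h(\chi(t)).$$ When $F=\emptyset$, these are denoted $\mathrm{fhtw}(Q)$, $\mathrm{subw}(Q)$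 and $\#\mathrm{subw}(Q)$, respectively. *)

(* Defs.v *)
From HB Require Import structures.
From mathcomp Require Import all_boot all_order all_algebra.
From mathcomp Require Import reals.

Set Implicit Arguments.
Unset Strict Implicit.
Unset Printing Implicit Defensive.

Import Order.TTheory GRing.Theory Num.Theory.

Local Open Scope ring_scope.

(* The multiset of hyperedges is the concatenation of two lists, so that
   repetitions are allowed, also across the two classes. *)
Record faq_query := FaqQuery {
  nvars : nat;
  edges_fin : seq {set 'I_nvars};
  edges_inf : seq {set 'I_nvars};
  free_vars : {set 'I_nvars};
  edges_fin_cover : \bigcup_(S <- edges_fin) S = [set: 'I_nvars]
}.

Definition hyperedges (Q : faq_query) : seq {set 'I_(nvars Q)} :=
  edges_fin Q ++ edges_inf Q.

Definition connected_in (T : finType) (e : rel T) (U : {set T}) : Prop :=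
  {in U &, forall x y,
     connect [rel a b | [&& e a b, a \in U & b \in U]] x y}.

Definition is_tree (T : finType) (e : rel T) : Prop :=
  [/\ (0 < #|T|)%N,
      symmetric e,
      irreflexive e,
      connected_in e [set: T]
    & forall c : seq T, (2 < size c)%N -> ~ ucycle e c].

Record tree_decomposition (Q : faq_query) := TreeDecomposition {
  node : finType;
  adj : rel node;
  bag : node -> {set 'I_(nvars Q)};
  adj_tree : is_tree adj;
  bag_edge : forall S, S \in hyperedges Q -> exists t, S \subset bag t;
  bag_nonempty : forall v, exists t, v \in bag t;
  bag_connected : forall v, connected_in adj [set t | v \in bag t]
}.

(* [connected_in] holds of the empty set, so V' may be empty. *)
Definition free_connex (Q : faq_query) (D : tree_decomposition Q) : Prop :=
  exists V' : {set node D},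
    connected_in (@adj Q D) V' /\ \bigcup_(t in V') bag t = free_vars Q.

Definition polymatroid (R : realType) (n : nat) (h : {set 'I_n} -> R) : Prop :=
  [/\ forall X : {set 'I_n}, 0 <= h X,
      h set0 = 0,
      forall X Y : {set 'I_n}, X \subset Y -> h X <= h Y
    & forall X Y : {set 'I_n}, h (X :|: Y) + h (X :&: Y) <= h X + h Y].

Definition edge_polymatroid (R : realType) (n : nat) (E : seq {set 'I_n})
    (h : {set 'I_n} -> R) : Prop :=
  [/\ forall X : {set 'I_n}, 0 <= h X,
      h set0 = 0,
      forall X Y : {set 'I_n}, X \subset Y -> h X <= h Y
    & forall X Y : {set 'I_n}, (exists2 S, S \in E & X :&: Y \subset S) ->
        h (X :|: Y) + h (X :&: Y) <= h X + h Y].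

Definition edge_dominated (R : realType) (n : nat) (E : seq {set 'I_n})
    (h : {set 'I_n} -> R) : Prop :=
  (forall X : {set 'I_n}, 0 <= h X) /\ (forall S, S \in E -> h S <= 1).

Definition is_max (R : realType) (A : R -> Prop) (m : R) : Prop :=
  A m /\ forall x, A x -> x <= m.

Definition is_min (R : realType) (A : R -> Prop) (m : R) : Prop :=
  A m /\ forall x, A x -> m <= x.

(* max_t h(chi(t)); the default value 0 is harmless: h is nonnegative and
   there is at least one node. *)
Definition max_bag (R : realType) (Q : faq_query)
    (h : {set 'I_(nvars Q)} -> R) (D : tree_decomposition Q) : R :=
  \big[Num.max/0]_(t : node D) h (bag t).

(* The widths are given as relations ("w is the width of Q"), so that each
   min and max is an attained one and no default value is involved. *)
Definition is_faqw (R : realType) (Q : faq_query) (w : R) : Prop :=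
  is_min (fun x => exists2 D : tree_decomposition Q, free_connex D &
    is_max (fun y => exists h : {set 'I_(nvars Q)} -> R,
      [/\ edge_dominated (edges_fin Q) h, polymatroid h & y = max_bag h D]) x) w.

Definition is_smfw (R : realType) (Q : faq_query) (w : R) : Prop :=
  is_max (fun x => exists h : {set 'I_(nvars Q)} -> R,
    [/\ edge_dominated (edges_fin Q) h,
        polymatroid h
      & is_min (fun y => exists2 D : tree_decomposition Q,
          free_connex D & y = max_bag h D) x]) w.

Definition is_sharp_smfw (R : realType) (Q : faq_query) (w : R) : Prop :=
  is_max (fun x => exists h : {set 'I_(nvars Q)} -> R,
    [/\ edge_dominated (edges_fin Q) h,
        edge_polymatroid (edges_fin Q) h
      & is_min (fun y => exists2 D : tree_decomposition Q,
          free_connex D & y = max_bag h D) x]) w.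

Definition is_fhtw (R : realType) (Q : faq_query) (w : R) : Prop :=
  free_vars Q = set0 /\ is_faqw Q w.

Definition is_subw (R : realType) (Q : faq_query) (w : R) : Prop :=
  free_vars Q = set0 /\ is_smfw Q w.

Definition is_sharp_subw (R : realType) (Q : faq_query) (w : R) : Prop :=
  free_vars Q = set0 /\ is_sharp_smfw Q w.

(* Main.v *)
(* The bounds smfw <= #smfw <= faqw rest on one observation: the increments of
   an edge polymatroid h along an enumeration of a bag B are the weights of a
   modular function with the same value on B and at most h on every finite edge,
   so a single bag cannot tell edge polymatroids from polymatroids.  Extrema are
   attained because the feasible h form a compact set and a tree decomposition
   only matters through its set of bags.

   For the gap take the complete bipartite graph K_(N,N) with binary finite
   edges and no free variables.  Every tree decomposition has a bag containing a
   whole side, an independent set of size N, so faqw >= N.  Conversely, let h be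
   a dominated edge polymatroid.  If some b on the right has h(b) >= 1/2, the
   edges at b meet in b, which gives h(left) <= N/2 + 1; otherwise
   h(right) <= N/2.  A star of bags "one side plus one vertex" then shows that
   #smfw <= N/2 + 2. *)
Require Import Defs.
From mathcomp Require Import all_boot all_order all_algebra.
From mathcomp Require Import reals.
From mathcomp Require Import lra.
From mathcomp Require boolp classical_sets topology normedtype derive.

Set Implicit Arguments.
Unset Strict Implicit.
Unset Printing Implicit Defensive.

Import Order.TTheory GRing.Theory Num.Theory.

Local Open Scope ring_scope.

(** * Trees *)

Section AvoidingConnectivity.
Variables (T : finType) (e : rel T).

Definition avoiding (t : T) : rel T := [rel a b | [&& e a b, a != t & b != t]].

Lemma path_avoiding t z p :
  path e z p -> t \notin z :: p -> path (avoiding t) z p.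
Proof.
move=> ep tp; apply: (@sub_in_path _ (predC1 t) e) ep => [a b|].
  by rewrite !inE => na nb eab; apply/and3P.
by apply/allP => x xp /=; apply: contraNneq tp => <-.
Qed.

(** A duplicate-free path never returns to its start, so past its first step it avoids [x]. *)
Lemma connect_first_step x y :
  connect e x y -> x != y -> exists2 z, e x z & connect (avoiding x) z y.
Proof.
case/connectP => p ep ->; case/shortenP: ep => -[|z s] /=; first by rewrite eqxx.
case/andP=> xz ezs /andP[xs _] _ _; exists z => //.
by apply/connectP; exists s => //; apply: path_avoiding.
Qed.

Lemma connected_in_avoiding t (U : {set T}) x y : connected_in e U ->
  t \notin U -> x \in U -> y \in U -> connect (avoiding t) x y.
Proof.
move=> cU tU xU yU; apply: connect_sub (cU x y xU yU) => a b /=.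
case/and3P=> eab aU bU; apply: connect1; apply/and3P.
by split=> //; [exact: (memPn tU _ aU) | exact: (memPn tU _ bU)].
Qed.

End AvoidingConnectivity.

Section Trees.
Variables (T : finType) (e : rel T).

Hypothesis tree_e : is_tree e.

Let sym_e : symmetric e. Proof. by case: tree_e. Qed.

Lemma avoiding_sym t : connect_sym (avoiding e t).
Proof.
apply: sym_connect_sym => a b.
by apply/and3P/and3P => -[? ? ?]; rewrite sym_e.
Qed.

(** Otherwise a duplicate-free path from [p] to [q] avoiding [t] would close up through [t] to a
    cycle of length at least three. *)
Lemma tree_neighbours_separated t p q :
  e t p -> e t q -> connect (avoiding e t) p q -> p = q.
Proof.
move=> etp etq /connectP[s avs def_q]; apply/eqP; apply: contraT => npq.
rewrite {q}def_q in etq npq; case/shortenP: avs etq npq => {}s avs uniq_s _ etq npq.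
case: s => [|z s] in avs uniq_s etq npq; first by rewrite eqxx in npq.
case: tree_e => _ _ _ _ /(_ (t :: p :: z :: s) isT) [].
have tNs : t \notin p :: z :: s.
  have /andP[/and3P[_ pt zt] {}avs] := avs.
  rewrite inE negb_or eq_sym pt /=.
  elim: s z zt avs {etq npq uniq_s} => [|w s IHs] z zt; first by rewrite inE eq_sym.
  by case/andP=> /and3P[_ _ wt] /(IHs w wt) tws; rewrite inE negb_or eq_sym zt.
rewrite /ucycle cons_uniq tNs uniq_s andbT.
rewrite /cycle -cats1 /= etp /= -/(path _ _ (z :: s)).
have -> : e p z by case/andP: avs => /and3P[].
rewrite /= cat_path /= sym_e etq !andbT.
by case/andP: avs => _; apply: sub_path => a b /and3P[].
Qed.

(** The iterates of [f] run into a cycle of [f], which is also a cycle of the tree: its length is at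
    most two by acyclicity, and not one by irreflexivity. *)
Lemma tree_bounce (f : T -> T) :
  (forall t, e t (f t)) -> exists t, f (f t) = t.
Proof.
move=> ef; have [/card_gt0P[x0 _] _ irr_e _ acyclic] := tree_e.
have /trajectP[i lt_i_n def_x] := looping_order f x0.
pose x := iter i f x0.
(* Of the equivalent items of [orbitPcycle], item 3 says that some positive iterate of [f] fixes
   [x], item 0 that its orbit is a cycle, item 4 that [iter (order f x) f x = x]. *)
have fcx : fcycle f (orbit f x).
  apply: (all_iffLR (@orbitPcycle _ f x) 3 0); exists (order f x0 - i).-1.
  by rewrite prednK ?subn_gt0 // /x -iterD subnK ?(ltnW lt_i_n).
have itx := all_iffLR (@orbitPcycle _ f x) 0 4 fcx.
have ordx : (order f x <= 2)%N.
  rewrite leqNgt -size_orbit; apply/negP => /acyclic; apply.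
  rewrite /ucycle orbit_uniq andbT.
  by apply: sub_cycle fcx => a b /eqP <-.
have := order_gt0 f x; case: (order f x) ordx itx => [|[|[|]]] //= _ fx _.
  by have := ef x; rewrite fx irr_e.
by exists x.
Qed.

(* If every node misses both a subtree of an [A]-vertex and one of a
   [B]-vertex, orient it towards the component containing these two subtrees.
   Since there is no cycle, some tree edge is oriented both ways, and the
   [A]-subtree seen on one side is disjoint from the [B]-subtree seen on the
   other. *)
Lemma tree_common_node (V : finType) (sub : V -> {set T}) (A B : {set V}) :
  (forall v, connected_in e (sub v)) ->
  (forall a b, a \in A -> b \in B -> exists t, (t \in sub a) && (t \in sub b)) ->
  exists t, (forall a, a \in A -> t \in sub a) \/
            (forall b, b \in B -> t \in sub b).
Proof.
move=> csub meet; have [_ _ irr_e conn_e _] := tree_e.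
pose toward t u (v : V) := [forall y in sub v, connect (avoiding e t) u y].
have [/existsP[t /orP[/forall_inP h|/forall_inP h]]|none] :=
  boolP [exists t, [forall a in A, t \in sub a] || [forall b in B, t \in sub b]].
- by exists t; left.
- by exists t; right.
have orient t : exists u, e t u /\
    [exists a in A, [exists b in B, toward t u a && toward t u b]].
  have := forallP (eq_rect _ is_true none _ (negb_exists _)) t.
  rewrite negb_or => /andP[/forall_inPn[a aA ta] /forall_inPn[b bB tb]].
  have [x /andP[xa xb]] := meet a b aA bB.
  have tx : t != x by apply: contraNneq ta => ->.
  have cTx : connect e t x.
    by apply: connect_sub (conn_e t x (in_setT _) (in_setT _)) => y z /and3P[/connect1].
  have [u etu cux] := connect_first_step cTx tx.
  exists u; split => //; apply/exists_inP; exists a => //; apply/exists_inP.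
  exists b => //; apply/andP; split; apply/forall_inP => y ys.
    exact: connect_trans cux (connected_in_avoiding (csub a) ta xa ys).
  exact: connect_trans cux (connected_in_avoiding (csub b) tb xb ys).
have [f /all_and2[ef fP]] := fin_all_exists orient.
have [t fft] := tree_bounce ef; set u := f t in fft.
case/exists_inP: (fP t) => a aA /exists_inP[_ _ /andP[/forall_inP ta _]].
case/exists_inP: (fP u) => _ _ /exists_inP[b bB /andP[_ /forall_inP ub]].
have [y /andP[ya yb]] := meet a b aA bB.
have {ta} cuy := ta y ya; have {ub} := ub y yb; rewrite fft => cty.
have etu : e t u := ef t.
have nty : t != y.
  apply: contraTneq cuy => <-; rewrite avoiding_sym; apply/negP => /connectP[[|z s]].
    by move=> _ /= def_u; have := irr_e t; rewrite -{2}def_u etu.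
  by case/andP=> /and3P[_]; rewrite eqxx.
(* The walk from [t] to [y] avoiding [u] starts with a neighbour [z] of [t] other than [u]; but [z]
   and [u] are joined through [y] without meeting [t], so they must coincide. *)
have [z /and3P[etz _ zu] czy] := connect_first_step cty nty.
have /(tree_neighbours_separated etu etz) def_z : connect (avoiding e t) u z.
  apply: connect_trans cuy _; rewrite avoiding_sym; apply: connect_sub czy => c d.
  by case/and3P=> /and3P[ecd _ _] ct dt; apply: connect1; apply/and3P.
by rewrite def_z eqxx in zu.
Qed.
End Trees.

(** * Star-shaped decompositions *)

Section Star.
Variable U : finType.

Definition star_rel : rel (option U) := [rel a b | isSome a != isSome b].

Lemma star_connected (W : {set option U}) :
  (None \in W \/ {in W &, forall x y, x = y}) -> connected_in star_rel W.
Proof.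
case=> [NW|W1] x y xW yW; last by rewrite (W1 x y xW yW) connect0.
have symW : connect_sym [rel a b | [&& star_rel a b, a \in W & b \in W]].
  apply: sym_connect_sym => a b.
  by apply/and3P/and3P => -[ab ? ?]; split=> //; rewrite /star_rel /= eq_sym.
have toN z : z \in W -> connect [rel a b | [&& star_rel a b, a \in W & b \in W]] z None.
  by case: z => [u|] uW; [apply: connect1; rewrite /= uW NW | apply: connect0].
by apply: connect_trans (toN x xW) _; rewrite symW; apply: toN.
Qed.

Lemma star_is_tree : is_tree star_rel.
Proof.
split=> [|a b|a||].
- by apply/card_gt0P; exists None.
- by case: a b => [?|] [?|].
- by case: a.
- by apply: star_connected; left; rewrite inE.
(* Centre and leaves alternate along a cycle: three nodes violate parity, four or more repeat the
   centre [None]. *)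
case=> [|x [|y [|z s]]] //= _ /andP[].
case: x y z => [x|] [y|] [z|] //=.
by case: s => [|[w|] s] //= _; rewrite andbF.
Qed.

End Star.

Section StarDecomposition.
Variables (Q : faq_query) (U : finType).
Variables (C : {set 'I_(nvars Q)}) (B : U -> {set 'I_(nvars Q)}).

Definition star_bag (t : option U) : {set 'I_(nvars Q)} :=
  if t is Some u then B u else C.

Hypothesis edgeB : forall S, S \in hyperedges Q -> exists u, S \subset B u.
Hypothesis BC : forall u u', u != u' -> B u :&: B u' \subset C.

Lemma star_bag_edge S : S \in hyperedges Q -> exists t, S \subset star_bag t.
Proof. by case/edgeB=> u; exists (Some u). Qed.

Lemma edges_fin_cover_vertex (v : 'I_(nvars Q)) :
  exists2 S, S \in edges_fin Q & v \in S.
Proof.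
have : v \in \bigcup_(S <- edges_fin Q) S by rewrite edges_fin_cover inE.
elim: (edges_fin Q) => [|S s IHs]; first by rewrite big_nil inE.
rewrite big_cons inE => /orP[vS|/IHs[S' S's vS']]; first by exists S; rewrite ?mem_head.
by exists S'; rewrite ?inE ?S's ?orbT.
Qed.

Lemma star_bag_nonempty v : exists t, v \in star_bag t.
Proof.
have [S SE vS] := edges_fin_cover_vertex v.
have [|t /subsetP St] := @star_bag_edge S; first by rewrite mem_cat SE.
by exists t; apply: St.
Qed.

Lemma star_bag_connected v :
  connected_in (@star_rel U) [set t | v \in star_bag t].
Proof.
apply: star_connected; rewrite inE /=; have [vC|vC] := boolP (v \in C); first by left.
right=> -[u|] [u'|]; rewrite !inE /= ?(negbTE vC) // => vu vu'.
apply/eqP; apply: contraNT vC => nuu'.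
by apply: (subsetP (BC (u := u) (u' := u') _)); rewrite // inE vu.
Qed.

Definition star_decomposition : tree_decomposition Q :=
  TreeDecomposition (star_is_tree U) star_bag_edge star_bag_nonempty
    star_bag_connected.

End StarDecomposition.

(** Two nodes suffice: a leaf carrying all vertices, and the centre carrying the free variables,
    which is the connex part. *)
Lemma free_connex_exists (Q : faq_query) :
  exists D : tree_decomposition Q, free_connex D.
Proof.
have e0 S : S \in hyperedges Q -> exists u : unit, S \subset [set: 'I_(nvars Q)].
  by exists tt; apply: subsetT.
have i0 (u u' : unit) : u != u' ->
    [set: 'I_(nvars Q)] :&: [set: 'I_(nvars Q)] \subset free_vars Q.
  by case: u u' => -[].
exists (star_decomposition e0 i0), [set None]; split.
  by apply: star_connected; left; rewrite inE.
by rewrite big_set1.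
Qed.

Lemma free_connex_no_free (Q : faq_query) (D : tree_decomposition Q) :
  free_vars Q = set0 -> free_connex D.
Proof.
by move=> F0; exists set0; split; [move=> x y; rewrite inE | rewrite big_set0].
Qed.

(** * Polymatroids restricted to edges *)

Section EdgePolymatroid.
Variables (R : realType) (n : nat) (E : seq {set 'I_n}).
Implicit Type h : {set 'I_n} -> R.

Lemma modular_polymatroid (w : 'I_n -> R) :
  (forall v, 0 <= w v) -> polymatroid (fun X : {set 'I_n} => \sum_(v in X) w v).
Proof.
move=> w0; split=> [X||X Y XY|X Y].
- exact: sumr_ge0.
- by rewrite big_set0.
- rewrite [leRHS](big_setID X) /= (setIidPr XY) lerDl; exact: sumr_ge0.
rewrite 4!(big_mkcond (fun v => v \in _)) -!big_split /=; apply: ler_sum => v _.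
by rewrite !inE; case: (v \in X); case: (v \in Y); rewrite /= ?addr0 ?add0r.
Qed.

Lemma polymatroid_edge_polymatroid h : polymatroid h -> edge_polymatroid E h.
Proof. by case=> h0 hz hm hs; split=> // X Y _; apply: hs. Qed.

(* Greedy weights along an enumeration of B: comparing the increments of [h]
   along B with those along [S :&: B] only uses submodularity for pairs meeting
   inside the edge S. *)
Lemma edge_polymatroid_modular_minorant h (B : {set 'I_n}) :
  edge_polymatroid E h ->
  exists w : 'I_n -> R,
    [/\ forall v, 0 <= w v,
        \sum_(v in B) w v = h B
      & forall S, S \in E -> \sum_(v in S) w v <= h S].
Proof.
case=> _ hz hm hs.
(* The induction carries more: the weights vanish off [s], and the weight of an edge is bounded by
   [h] of its part inside [s]. *)
suff: forall s : seq 'I_n, uniq s -> exists w : 'I_n -> R,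
    [/\ forall v, 0 <= w v, forall v, v \notin s -> w v = 0,
        \sum_(v in [set x in s]) w v = h [set x in s]
      & forall S, S \in E -> \sum_(v in S) w v <= h (S :&: [set x in s])].
  move=> /(_ (enum B) (enum_uniq _)); rewrite set_enum => -[w [w0 _ wB wE]].
  exists w; split=> // S SE; apply: le_trans (wE S SE) _.
  exact/hm/subsetIl.
elim=> [_|x s IHs /= /andP[xs /IHs[w [w0 ws wB wE]]]].
  have -> : [set x in [::]] = set0 :> {set 'I_n} by apply/setP => v; rewrite !inE.
  exists (fun=> 0); split=> // [|S _]; rewrite ?setI0 hz ?big_set0 //.
  by rewrite big1.
rewrite set_cons; set X := [set x in s] in wB wE *.
pose d := h (x |: X) - h X.
have sumd (S : {set 'I_n}) :
    \sum_(v in S) (w v + (if v == x then d else 0)) =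
    \sum_(v in S) w v + (if x \in S then d else 0).
  rewrite big_split /= -big_mkcondr; congr (_ + _); case: ifP => xS.
    rewrite (big_pred1 x) // => v /=.
    by case: eqP => [->|_]; rewrite ?xS ?andbF ?andbT.
  by rewrite big_pred0 // => v; case: eqP => [->|_]; rewrite ?xS ?andbF.
exists (fun v => w v + (if v == x then d else 0)); split.
- move=> v; rewrite addr_ge0 //; case: ifP => // _.
  by rewrite subr_ge0 hm // subsetUr.
- move=> v; rewrite inE negb_or => /andP[/negbTE-> vs].
  by rewrite ws // addr0.
- rewrite sumd setU11 big_setU1 /=; last by rewrite inE.
  by rewrite wB ws // add0r addrC subrK.
- move=> S SE; rewrite sumd; have wS := wE S SE; case: ifP => xS.
    have := hs (S :&: (x |: X)) X.
    have -> : S :&: (x |: X) :|: X = x |: X.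
      apply/setP => v; rewrite !inE.
      case: eqP => [->|_] /=; first by rewrite xS.
      by case: (v \in s); rewrite ?orbT ?andbF.
    have -> : S :&: (x |: X) :&: X = S :&: X.
      by apply/setP => v; rewrite !inE; case: (v \in s); rewrite ?orbT ?andbT ?andbF.
    have ex : exists2 S0, S0 \in E & S :&: X \subset S0.
      by exists S => //; apply: subsetIl.
    by move=> /(_ ex); rewrite /d; lra.
  rewrite addr0 (_ : S :&: (x |: X) = S :&: X) //.
  by apply/setP => v; rewrite !inE; case: eqP => [->|]; rewrite ?xS.
Qed.

(** The modular minorant is a polymatroid, and lying below [h] on the edges keeps it dominated. *)
Lemma edge_polymatroid_same_value h (B : {set 'I_n}) :
  edge_dominated E h -> edge_polymatroid E h ->
  exists g : {set 'I_n} -> R,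
    [/\ edge_dominated E g, polymatroid g & g B = h B].
Proof.
case=> _ h1 /(edge_polymatroid_modular_minorant B)[w [w0 wB wE]].
have pw := modular_polymatroid w0.
exists (fun X : {set 'I_n} => \sum_(v in X) w v); split=> //; split; first by case: pw.
by move=> S SE; apply: le_trans (wE S SE) (h1 S SE).
Qed.

(** Every vertex lies in an edge, so each weight of the modular minorant is at most 1. This uniform
    bound is what compactness needs. *)
Lemma edge_polymatroid_le h (B : {set 'I_n}) :
  (forall v, exists2 S, S \in E & v \in S) ->
  edge_dominated E h -> edge_polymatroid E h -> h B <= n%:R.
Proof.
move=> cover [_ h1] ph.
have [w [w0 <- wE]] := edge_polymatroid_modular_minorant B ph.
apply: (@le_trans _ _ (\sum_(v in B) 1)).
  apply: ler_sum => v _; have [S SE vS] := cover v.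
  apply: le_trans (h1 S SE); apply: le_trans (wE S SE).
  by rewrite (bigD1 v) //= lerDl sumr_ge0.
by rewrite sumr_const ler_nat -[leqRHS]card_ord max_card.
Qed.

(** The petals [x |: Z] are added one at a time. Each meets the union of the earlier ones in the
    core [Z], which lies in an edge, so submodularity applies and the cost is at most [c]. *)
Lemma edge_polymatroid_sunflower h (Z S0 A : {set 'I_n}) (c : R) :
  edge_polymatroid E h -> S0 \in E -> Z \subset S0 -> [disjoint A & Z] ->
  (forall x, x \in A -> h (x |: Z) <= h Z + c) ->
  h (A :|: Z) <= h Z + #|A|%:R * c.
Proof.
case=> _ hz hm hs S0E ZS0; rewrite disjoint_subset => /subsetP AZ hc.
suff: forall s : seq 'I_n, uniq s -> {subset s <= A} ->
    h ([set x in s] :|: Z) <= h Z + (size s)%:R * c.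
  move=> /(_ (enum A) (enum_uniq _)); rewrite set_enum -cardE; apply.
  by move=> x; rewrite mem_enum.
elim=> [_ _|x s IHs /= /andP[xs us] sA].
  have -> : [set x in [::]] = set0 :> {set 'I_n} by apply/setP => v; rewrite !inE.
  by rewrite set0U mul0r addr0.
have xA : x \in A by rewrite sA ?mem_head.
have {IHs} IHs : h ([set x in s] :|: Z) <= h Z + (size s)%:R * c.
  by apply: IHs => // y ys; apply: sA; rewrite inE ys orbT.
have := hs ([set x in s] :|: Z) (x |: Z).
have -> : ([set x in s] :|: Z) :|: (x |: Z) = [set y in x :: s] :|: Z.
  by apply/setP => v; rewrite !inE; do !case: (_ \in _); rewrite ?orbT ?orbF.
have -> : ([set x in s] :|: Z) :&: (x |: Z) = Z.
  apply/setP => v; rewrite !inE.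
  case: eqP => [->|_] /=; last by case: (v \in Z); rewrite ?orbT ?andbF.
  by rewrite (negbTE xs) andbT.
have ex : exists2 S0, S0 \in E & Z \subset S0 by exists S0.
move=> /(_ ex); have := hc x xA; rewrite -addn1 natrD mulrDl; lra.
Qed.

End EdgePolymatroid.

(** * Attained extrema *)

(* [C] is the set of pairs at which submodularity is required: all pairs for
   polymatroids, those meeting inside an edge for edge polymatroids. *)
Definition feasible (R : realType) (n : nat) (E : seq {set 'I_n})
    (C : {set 'I_n} -> {set 'I_n} -> Prop) (h : {set 'I_n} -> R) : Prop :=
  edge_dominated E h /\
  [/\ forall X : {set 'I_n}, 0 <= h X,
      h set0 = 0,
      forall X Y : {set 'I_n}, X \subset Y -> h X <= h Y
    & forall X Y : {set 'I_n}, C X Y ->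
        h (X :|: Y) + h (X :&: Y) <= h X + h Y].

Definition max_over (R : realType) (n : nat) (h : {set 'I_n} -> R)
    (B : {set {set 'I_n}}) : R :=
  \big[Num.max/0]_(X in B) h X.

(* [B0] only makes the minimum total; it is meant to be a member of [F], except
   that [F] empty gives [max_over h B0]. *)
Definition min_max_over (R : realType) (n : nat) (B0 : {set {set 'I_n}})
    (F : {set {set {set 'I_n}}}) (h : {set 'I_n} -> R) : R :=
  \big[Num.min/max_over h B0]_(B in F) max_over h B.

(** * Compactness of the feasible set and continuity of the objective *)

Section Compactness.
Import boolp classical_sets topology normedtype derive.
Import numFieldNormedType.Exports.
Local Open Scope classical_set_scope.

Variables (R : realType) (n : nat).
Let space : topologicalType := {ptws {set 'I_n} -> R}.

Let eval_continuous (X : {set 'I_n}) : continuous (fun h : space => h X).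
Proof. exact: (@proj_continuous _ (fun _ : {set 'I_n} => R) X). Qed.

Let closed_le_fun (f g : space -> R) : continuous f -> continuous g ->
  closed [set h | f h <= g h].
Proof.
move=> cf cg; rewrite (_ : mkset _ = (g \- f) @^-1` [set x | 0 <= x]).
  apply: (closed_comp _ (@closed_ge _ 0)) => h _.
  by apply: continuousB; [exact: cg|exact: cf].
by apply/seteqP; split=> h /=; rewrite subr_ge0.
Qed.

Let closed_forall I (P : I -> set space) :
  (forall i, closed (P i)) -> closed [set h | forall i, P i h].
Proof.
move=> cP; rewrite (_ : mkset _ = \bigcap_(i in setT) P i).
  exact: closed_bigI.
by apply/seteqP; split=> h Ph i; [move=> _|]; apply: Ph.
Qed.

Let closed_imply (A : Prop) (P : set space) :
  closed P -> closed [set h | A -> P h].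
Proof.
by move=> cP; apply: (closed_forall (P := fun _ : A => P)).
Qed.

Let const_continuous (x : R) : continuous (fun _ : space => x).
Proof. exact: cst_continuous. Qed.

Lemma closed_feasible E C : closed [set h : space | feasible E C h].
Proof.
have ge0 : closed [set h : space | forall X, 0 <= h X].
  by apply: closed_forall => X; apply: closed_le_fun.
(* All conditions become weak inequalities between continuous functions of [h]; [h set0 = 0] is
   recovered from [<= 0] and nonnegativity. *)
have -> : [set h : space | feasible E C h] =
   [set h : space | forall X, 0 <= h X] `&`
   [set h : space | forall S, S \in E -> h S <= 1] `&`
   [set h : space | h finset.set0 <= 0] `&`
   [set h : space | forall X Y : {set 'I_n}, X \subset Y -> h X <= h Y] `&`
   [set h : space | forall X Y : {set 'I_n}, C X Y ->
      h (X :|: Y)%SET + h (X :&: Y)%SET <= h X + h Y].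
  apply/seteqP; split=> h /=.
    by case=> -[h0 h1] [_ -> hm hs]; rewrite lexx.
  case=> [[[[h0 h1] hz] hm] hs]; do 2!split=> //.
  by apply/eqP; rewrite eq_le hz h0.
apply: closedI; [apply: closedI; [apply: closedI; [apply: closedI => //|]|]|].
- by apply: closed_forall => S; apply: closed_imply; apply: closed_le_fun.
- exact: closed_le_fun.
- apply: closed_forall => X; apply: closed_forall => Y.
  by apply: closed_imply; apply: closed_le_fun.
- apply: closed_forall => X; apply: closed_forall => Y.
  by apply: closed_imply; apply: closed_le_fun => h;
     apply: continuousD; apply: eval_continuous.
Qed.

Lemma max_over_continuous (B : {set {set 'I_n}}) :
  continuous (fun h : space => max_over h B).
Proof.
rewrite /max_over; elim: (index_enum _) => [|X s IHs].
  by under eq_fun do rewrite big_nil; apply: const_continuous.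
under eq_fun do rewrite big_cons.
case: (X \in B); last exact: IHs.
by move=> h; apply: continuous_max; [exact: eval_continuous|exact: IHs].
Qed.

Lemma min_max_over_continuous B0 (F : {set {set {set 'I_n}}}) :
  continuous (fun h : space => min_max_over B0 F h).
Proof.
rewrite /min_max_over; elim: (index_enum _) => [|B s IHs].
  by under eq_fun do rewrite big_nil; apply: max_over_continuous.
under eq_fun do rewrite big_cons.
case: (B \in F); last exact: IHs.
by move=> h; apply: continuous_min; [exact: max_over_continuous|exact: IHs].
Qed.

(** The feasible set contains 0 and is closed in a product of segments [[0, M]], compact by
    Tychonoff; the extreme value theorem applies. *)
Lemma feasible_argmax (E : seq {set 'I_n}) C B0 F (M : R) :
  (forall h : {set 'I_n} -> R, feasible E C h -> forall X, h X <= M) ->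
  exists2 h : {set 'I_n} -> R, feasible E C h &
    forall h', feasible E C h' -> min_max_over B0 F h' <= min_max_over B0 F h.
Proof.
move=> bnd; pose K := [set h : space | feasible E C h].
have K0 : K !=set0.
  exists (fun=> 0); split; split=> // *; rewrite ?addr0 //.
have cK : compact K.
  apply: (@subclosed_compact _ _ [set h : space | forall X, `[0, M] (h X)]).
  - exact: closed_feasible.
  - exact: (@tychonoff _ (fun _ : {set 'I_n} => R) (fun=> `[0, M]%classic)
      (fun=> @segment_compact R 0 M)).
  - move=> h Kh X; rewrite /= in_itv /= (bnd h) // andbT.
    by case: Kh => -[].
have [h Kh maxh] := compact_EVT_max K0 cK
  (continuous_subspaceT (@min_max_over_continuous B0 F)).
exists h; first by rewrite inE in Kh.
by move=> h' Kh'; apply: maxh; rewrite inE.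
Qed.

End Compactness.

(** * The widths *)

Section Widths.
Variables (R : realType) (Q : faq_query).
Let n := nvars Q.
Implicit Types (h : {set 'I_n} -> R) (D : tree_decomposition Q).

Definition bags D : {set {set 'I_n}} := [set bag t | t in [set: node D]].

Lemma max_bag_bags h D : max_bag h D = max_over h (bags D).
Proof. by rewrite /max_over bigmax_imset; apply: eq_bigl => t; rewrite inE. Qed.

(** Decompositions do not form a finite type, but their sets of bags do; this makes the minimum over
    decompositions a finite one. *)
Definition free_connex_bags : {set {set {set 'I_n}}} :=
  [set B | boolp.asbool (exists2 D, free_connex D & bags D = B)].

Lemma free_connex_bagsP B :
  reflect (exists2 D, free_connex D & bags D = B) (B \in free_connex_bags).
Proof. by rewrite inE; apply: boolp.asboolP. Qed.

Lemma min_over_decompositions h D0 : free_connex D0 ->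
  is_min (fun y => exists2 D, free_connex D & y = max_bag h D)
    (min_max_over (bags D0) free_connex_bags h).
Proof.
move=> fD0; split.
  apply: (big_ind (fun y => exists2 D, free_connex D & y = max_bag h D)).
  - by exists D0; rewrite ?max_bag_bags.
  - by move=> x y xP yP; rewrite /Num.min; case: ifP.
  - by move=> B /free_connex_bagsP[D fD <-]; exists D; rewrite ?max_bag_bags.
move=> _ [D fD ->]; rewrite max_bag_bags.
by apply: bigmin_le_cond; apply/free_connex_bagsP; exists D.
Qed.

Lemma is_min_unique (P : R -> Prop) x y : is_min P x -> is_min P y -> x = y.
Proof. by case=> Px xm [Py ym]; apply/le_anti; rewrite xm // ym. Qed.

Let anywhere (X Y : {set 'I_n}) := True.
Let in_edge (X Y : {set 'I_n}) := exists2 S, S \in edges_fin Q & X :&: Y \subset S.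

Lemma feasible_anywhere h :
  feasible (edges_fin Q) anywhere h <->
  edge_dominated (edges_fin Q) h /\ polymatroid h.
Proof.
by split=> -[hd [h0 hz hm hs]]; do 2!split=> //; move=> X Y *; apply: hs.
Qed.

Lemma edge_polymatroid_le_nvars h :
  edge_dominated (edges_fin Q) h -> edge_polymatroid (edges_fin Q) h ->
  forall X, h X <= n%:R.
Proof.
by move=> hd hp X; apply: edge_polymatroid_le hd hp; apply: edges_fin_cover_vertex.
Qed.

Lemma feasible_anywhere_le h :
  feasible (edges_fin Q) anywhere h -> forall X, h X <= n%:R.
Proof.
move=> /feasible_anywhere[hd hp]; apply: edge_polymatroid_le_nvars => //.
exact: polymatroid_edge_polymatroid.
Qed.

Lemma is_smfw_exists : exists s : R, is_smfw Q s.
Proof.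
have [D0 fD0] := free_connex_exists Q.
have [h /feasible_anywhere[hd hp] hmax] :=
  feasible_argmax (bags D0) free_connex_bags feasible_anywhere_le.
exists (min_max_over (bags D0) free_connex_bags h); split.
  by exists h; split=> //; apply: min_over_decompositions.
move=> _ [h' [hd' hp' /is_min_unique /(_ (min_over_decompositions h' fD0))->]].
by apply: hmax; apply/feasible_anywhere.
Qed.

Lemma is_sharp_smfw_exists : exists ss : R, is_sharp_smfw Q ss.
Proof.
have [D0 fD0] := free_connex_exists Q.
have bnd h : feasible (edges_fin Q) in_edge h -> forall X, h X <= n%:R.
  by case=> hd hp; apply: edge_polymatroid_le_nvars.
have [h [hd hp] hmax] := feasible_argmax (bags D0) free_connex_bags bnd.
exists (min_max_over (bags D0) free_connex_bags h); split.
  by exists h; split=> //; apply: min_over_decompositions.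
move=> _ [h' [hd' hp' /is_min_unique /(_ (min_over_decompositions h' fD0))->]].
exact: hmax.
Qed.

Lemma is_faqw_exists : exists f : R, is_faqw Q f.
Proof.
have max_over_bags (B : {set {set 'I_n}}) : exists m : R, is_max (fun y => exists h,
    [/\ edge_dominated (edges_fin Q) h, polymatroid h & y = max_over h B]) m.
  (* For the empty family [min_max_over] is its default [max_over h B], so this maximises over a
     single set of bags. *)
  have [h /feasible_anywhere[hd hp] hmax] :=
    feasible_argmax B set0 feasible_anywhere_le.
  exists (max_over h B); split; first by exists h.
  move=> _ [h' [hd' hp' ->]].
  have := hmax h'; rewrite /min_max_over !big_set0; apply.
  exact/feasible_anywhere.
have [m mP] := fin_all_exists max_over_bags.
have max_bag_m D : is_max (fun y => exists h,
    [/\ edge_dominated (edges_fin Q) h, polymatroid h & y = max_bag h D]) (m (bags D)).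
  have [[h [hd hp hm]] hmax] := mP (bags D); split.
    by exists h; rewrite max_bag_bags.
  by move=> _ [h' [hd' hp' ->]]; apply: hmax; exists h'; rewrite max_bag_bags.
have [D0 fD0] := free_connex_exists Q.
have B0 : bags D0 \in free_connex_bags by apply/free_connex_bagsP; exists D0.
case: (arg_minP m B0) => _ /free_connex_bagsP[D fD <-] minD.
exists (m (bags D)); split; first by exists D.
move=> x [D' fD' [_ xmax]]; apply: le_trans (xmax _ (proj1 (max_bag_m D'))).
by apply: minD; apply/free_connex_bagsP; exists D'.
Qed.

Lemma smfw_le_sharp_smfw (s ss : R) :
  is_smfw Q s -> is_sharp_smfw Q ss -> s <= ss.
Proof.
move=> [[h [hd hp hmin]] _] [_]; apply; exists h; split=> //.
exact: polymatroid_edge_polymatroid.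
Qed.

(** With [h] attaining [ss] and [D] attaining [f], it is enough to bound [h] on each bag of [D]
    separately, so the polymatroid replacing [h] may change with the bag. *)
Lemma sharp_smfw_le_faqw (ss f : R) :
  is_sharp_smfw Q ss -> is_faqw Q f -> ss <= f.
Proof.
move=> [[h [hd hp [_ hmin]]] _] [[D fD [[g0 [_ _ def_f]] maxD]] _].
apply: le_trans (hmin _ (ex_intro2 _ _ D fD erefl)) _.
(* The default value of the maximum demands [0 <= f], which holds as [f] is itself a [max_bag]. *)
apply/bigmax_leP; split=> [|t _]; first by rewrite def_f; apply: bigmax_ge_id.
have [g [gd gp <-]] := edge_polymatroid_same_value (bag t) hd hp.
apply: le_trans (maxD (max_bag g D) _); last by exists g.
exact: (@le_bigmax _ _ _ _ (fun t => g (bag t))).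
Qed.

End Widths.

(** * Complete bipartite queries *)

(** Counting the elements of [A] is a modular polymatroid, dominated because [A] is independent, and
    worth [N] on the bag. *)
Lemma faqw_ge_independent (R : realType) (Q : faq_query) (N : nat) (f : R) :
  (forall D : tree_decomposition Q, exists (t : node D) (A : {set 'I_(nvars Q)}),
     [/\ #|A| = N, A \subset bag t
       & forall S, S \in edges_fin Q -> (#|S :&: A| <= 1)%N]) ->
  is_faqw Q f -> N%:R <= f.
Proof.
move=> indep [[D _ [_ maxD]] _]; have [t [A [cardA At AE]]] := indep D.
pose h (X : {set 'I_(nvars Q)}) : R := \sum_(v in X) (v \in A)%:R.
have hE X : h X = #|X :&: A|%:R.
  rewrite /h -sum1_card natr_sum big_mkcond [RHS]big_mkcond /=.
  by apply: eq_bigr => v _; rewrite inE; case: (v \in X); case: (v \in A).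
have hp : polymatroid h by apply: modular_polymatroid.
have hd : edge_dominated (edges_fin Q) h.
  by split=> [|S SE]; [case: hp | rewrite hE lern1 AE].
apply: le_trans (maxD (max_bag h D) _); last by exists h.
apply: le_trans (le_bigmax _ (fun t => h (bag t)) t).
by rewrite hE (setIidPr At) cardA.
Qed.

Definition biclique_between (Q : faq_query) (A B : {set 'I_(nvars Q)}) : Prop :=
  [/\ [disjoint A & B],
      forall S, S \in hyperedges Q ->
        exists a b, [/\ a \in A, b \in B & S = [set a; b]]
    & forall a b, a \in A -> b \in B -> [set a; b] \in edges_fin Q].

Lemma biclique_between_sym Q A B :
  @biclique_between Q A B -> biclique_between B A.
Proof.
case=> dAB edgeAB ABedge; split=> [|S /edgeAB[a [b [aA bB ->]]]|b a bB aA].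
- by rewrite disjoint_sym.
- by exists b, a; rewrite setUC.
- by rewrite setUC ABedge.
Qed.

Section Biclique.
Variables (R : realType) (Q : faq_query) (A B : {set 'I_(nvars Q)}).
Hypothesis bicl : biclique_between A B.

(** The centre is [A] and the leaves are all [v |: A]; those with [v] in [A] harmlessly repeat the
    centre. *)
Lemma biclique_star_decomposition : exists D : tree_decomposition Q,
  forall (h : {set 'I_(nvars Q)} -> R) (c : R), 0 <= c -> h A <= c ->
    (forall v, h (v |: A) <= c) -> max_bag h D <= c.
Proof.
have [_ edgeAB _] := bicl.
have e1 S : S \in hyperedges Q -> exists v, S \subset v |: A.
  by case/edgeAB=> a [b [aA _ ->]]; exists b; rewrite setUC setUS ?sub1set.
have e2 u u' : u != u' -> (u |: A) :&: (u' |: A) \subset A.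
  move=> nuu'; apply/subsetP => v; rewrite !inE.
  by case/andP=> /predU1P[->|//]; rewrite (negbTE nuu').
exists (star_decomposition e1 e2) => h c c0 hA hvA.
by apply/bigmax_leP; split=> // -[v|] _; [apply: hvA | apply: hA].
Qed.

(** The edge joining [a] to [b] lies in a bag, so their subtrees meet and [tree_common_node]
    applies. *)
Lemma biclique_bag (D : tree_decomposition Q) :
  exists t : node D, A \subset bag t \/ B \subset bag t.
Proof.
have [_ _ ABedge] := bicl.
have [|t AB] := tree_common_node (adj_tree D) (@bag_connected Q D) (A := A) (B := B).
  move=> a b aA bB; have [|t abt] := @bag_edge Q D [set a; b].
    by rewrite mem_cat ABedge.
  by exists t; move: abt; rewrite subUset !sub1set !inE.
exists t; case: AB => [At|Bt]; [left|right]; apply/subsetP => v.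
  by move/At; rewrite inE.
by move/Bt; rewrite inE.
Qed.

Lemma biclique_independent S : S \in edges_fin Q -> (#|S :&: A| <= 1)%N.
Proof.
have [dAB edgeAB _] := bicl => SE.
have [|a [b [aA bB ->]]] := edgeAB S; first by rewrite mem_cat SE.
rewrite -(cards1 a); apply/subset_leq_card/subsetP => v.
rewrite !inE => /andP[/orP[//|/eqP-> bA]].
by rewrite (disjointFl dAB bB) in bA.
Qed.

Variable h : {set 'I_(nvars Q)} -> R.
Hypotheses (hd : edge_dominated (edges_fin Q) h)
  (hp : edge_polymatroid (edges_fin Q) h).

(** A singleton lies in an edge, so it is submodular against any set. *)
Lemma edge_polymatroid_add_vertex v X : h (v |: X) <= h X + 1.
Proof.
have [S SE vS] := edges_fin_cover_vertex v.
have [_ h1] := hd; have [h0 _ hm hs] := hp.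
have hv : h [set v] <= 1 by apply: le_trans (h1 S SE); rewrite hm ?sub1set.
have ex : exists2 S, S \in edges_fin Q & [set v] :&: X \subset S.
  by exists S => //; apply: subset_trans (subsetIl _ _) _; rewrite sub1set.
by have := hs _ _ ex; have := h0 ([set v] :&: X); lra.
Qed.

(** Sunflower with core [[set b]]: each edge at [b] gains at most [1 - h [set b] <= 1 / 2], and the
    final 1 bounds the core. *)
Lemma biclique_heavy_vertex a0 b : a0 \in A -> b \in B -> 1 / 2 <= h [set b] ->
  h A <= #|A|%:R / 2 + 1.
Proof.
have [dAB _ ABedge] := bicl => a0A bB hb; have [_ h1] := hd; have [h0 _ hm _] := hp.
have hb1 : h [set b] <= 1.
  by apply: le_trans (h1 _ (ABedge a0 b a0A bB)); rewrite hm ?subsetUr.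
have := @edge_polymatroid_sunflower R _ (edges_fin Q) h [set b] [set a0; b] A
  (1 - h [set b]) hp (ABedge _ _ a0A bB) (subsetUr _ _).
rewrite disjoint_sym disjoints1 (disjointFl dAB bB) => /(_ isT) H.
have {}H : h (A :|: [set b]) <= h [set b] + #|A|%:R * (1 - h [set b]).
  by apply: H => a aA; rewrite addrC subrK h1 ?ABedge.
have hA : h A <= h (A :|: [set b]) by rewrite hm ?subsetUl.
have : #|A|%:R * (1 - h [set b]) <= #|A|%:R * (1 / 2).
  by rewrite ler_wpM2l //; lra.
lra.
Qed.

(** Sunflower with empty core, that is, subadditivity over singletons; [a0] and [b0] supply an edge
    containing the core. *)
Lemma biclique_light_vertices b0 a0 : a0 \in A -> b0 \in B ->
  (forall b, b \in B -> h [set b] <= 1 / 2) -> h B <= #|B|%:R / 2.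
Proof.
have [_ _ ABedge] := bicl => a0A b0B hb; have [_ hz _ _] := hp.
have := @edge_polymatroid_sunflower R _ (edges_fin Q) h set0 [set a0; b0] B
  (1 / 2) hp (ABedge _ _ a0A b0B) (sub0set _).
rewrite disjoint_sym disjoints_subset sub0set setU0 hz => /(_ isT) H.
suff : h B <= 0 + #|B|%:R * (1 / 2) by lra.
by apply: H => b bB; rewrite setU0 add0r hb.
Qed.

End Biclique.

Lemma biclique_sharp_smfw_le (R : realType) (Q : faq_query)
    (A B : {set 'I_(nvars Q)}) (N : nat) (ss : R) :
  biclique_between A B -> (0 < N)%N -> #|A| = N -> #|B| = N ->
  free_vars Q = set0 -> is_sharp_smfw Q ss -> ss <= N%:R / 2 + 2.
Proof.
move=> bicl N0 cA cB F0 [[h [hd hp [_ minh]]] _].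
have le_ss D c : max_bag h D <= c -> ss <= c.
  by apply: le_trans; apply: minh; exists D => //; apply: free_connex_no_free.
have N_ge0 : 0 <= N%:R :> R by [].
have /card_gt0P[a aA] : (0 < #|A|)%N by rewrite cA.
have /card_gt0P[b bB] : (0 < #|B|)%N by rewrite cB.
have addv := edge_polymatroid_add_vertex hd hp.
have [/exists_inP[b' b'B hb']|light] := boolP [exists b in B, 1 / 2 <= h [set b]].
  have hA := biclique_heavy_vertex bicl hd hp aA b'B hb'; rewrite cA in hA.
  have [D maxD] := biclique_star_decomposition R bicl.
  apply: (le_ss D); apply: maxD => [||v]; [lra|lra|].
  (* The extra vertex costs another 1 on top of [N / 2 + 1], whence the constant 2. *)
  by have := addv v A; lra.
have hB : h B <= N%:R / 2.
  rewrite -cB; apply: (biclique_light_vertices bicl hp aA bB) => b' b'B.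
  by rewrite ltW // ltNge; apply: contraNN light => ?; apply/exists_inP; exists b'.
have [D maxD] := biclique_star_decomposition R (biclique_between_sym bicl).
apply: (le_ss D); apply: maxD => [||v]; [lra|lra|].
by have := addv v B; lra.
Qed.

Lemma biclique_faqw_ge (R : realType) (Q : faq_query)
    (A B : {set 'I_(nvars Q)}) (N : nat) (f : R) :
  biclique_between A B -> #|A| = N -> #|B| = N -> is_faqw Q f -> N%:R <= f.
Proof.
move=> bicl cA cB; apply: faqw_ge_independent => D.
have [t [At|Bt]] := biclique_bag bicl D; exists t; [exists A|exists B]; split=> //.
  exact: (biclique_independent bicl).
exact: (biclique_independent (biclique_between_sym bicl)).
Qed.

(** * The query of the complete bipartite graph with sides of size [N.+1] *)

Section BicliqueQuery.
Variable N : nat.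
Let vertex := 'I_(N.+1 + N.+1).

Definition biclique_edges : seq {set vertex} :=
  [seq [set lshift N.+1 i; rshift N.+1 j] | i <- enum 'I_N.+1, j <- enum 'I_N.+1].

Lemma biclique_edges_cover : \bigcup_(S <- biclique_edges) S = [set: vertex].
Proof.
apply/setP => v; rewrite inE.
have edge_in u S : S \in biclique_edges -> u \in S ->
    u \in \bigcup_(S <- biclique_edges) S.
  by move=> SE uS; rewrite (big_rem S SE) inE uS.
rewrite -(splitK v); case: (split v) => /= i.
  apply: (edge_in _ [set lshift N.+1 i; rshift N.+1 ord0]); last by rewrite !inE eqxx.
  by apply: allpairs_f; rewrite mem_enum.
apply: (edge_in _ [set lshift N.+1 ord0; rshift N.+1 i]); last by rewrite !inE eqxx orbT.
by apply: allpairs_f; rewrite mem_enum.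
Qed.

Definition biclique_query : faq_query :=
  FaqQuery [::] set0 biclique_edges_cover.

Let left_side : {set vertex} := [set lshift N.+1 i | i in [set: 'I_N.+1]].
Let right_side : {set vertex} := [set rshift N.+1 i | i in [set: 'I_N.+1]].

Lemma biclique_query_between : @biclique_between biclique_query left_side right_side.
Proof.
split=> [|S|a b].
- rewrite disjoint_subset; apply/subsetP => _ /imsetP[i _ ->]; rewrite inE.
  by apply/imsetP => -[j _ /eqP]; rewrite eq_lrshift.
- rewrite /hyperedges cats0 => /allpairsP[[i j] [_ _ ->]].
  by exists (lshift N.+1 i), (rshift N.+1 j); rewrite !imset_f ?inE.
- move=> /imsetP[i _ ->] /imsetP[j _ ->].
  by apply: allpairs_f; rewrite mem_enum.
Qed.

Lemma biclique_query_gap (R : realType) (ss f : R) :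
  is_sharp_smfw biclique_query ss -> is_faqw biclique_query f ->
  N.+1%:R / 2 - 2 <= f - ss.
Proof.
have cl : #|left_side| = N.+1.
  by rewrite card_imset ?cardsT ?card_ord //; apply: lshift_inj.
have cr : #|right_side| = N.+1.
  by rewrite card_imset ?cardsT ?card_ord //; apply: rshift_inj.
move=> /(biclique_sharp_smfw_le biclique_query_between (ltn0Sn N) cl cr erefl) ub.
move=> /(biclique_faqw_ge biclique_query_between cl cr) lb.
lra.
Qed.

End BicliqueQuery.

Theorem proposition3p16 (R : realType) :
  [/\ (forall Q : faq_query, exists s ss f : R,
         [/\ is_smfw Q s, is_sharp_smfw Q ss, is_faqw Q f & s <= ss <= f]),
      (forall Q : faq_query, free_vars Q = set0 -> exists s ss f : R,
         [/\ is_subw Q s, is_sharp_subw Q ss, is_fhtw Q f & s <= ss <= f]),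
      (forall c : R, exists (Q : faq_query) (ss f : R),
         [/\ is_sharp_smfw Q ss, is_faqw Q f & c < f - ss])
    & (forall c : R, exists (Q : faq_query) (ss f : R),
         [/\ free_vars Q = set0, is_sharp_subw Q ss, is_fhtw Q f & c < f - ss])].
Proof.
have widths (Q : faq_query) : exists s ss f : R,
    [/\ is_smfw Q s, is_sharp_smfw Q ss, is_faqw Q f & s <= ss <= f].
  have [s sP] := is_smfw_exists R Q; have [ss ssP] := is_sharp_smfw_exists R Q.
  have [f fP] := is_faqw_exists R Q; exists s, ss, f; split=> //.
  by rewrite (smfw_le_sharp_smfw sP ssP) (sharp_smfw_le_faqw ssP fP).
have gap (c : R) : exists (Q : faq_query) (ss f : R),
    [/\ free_vars Q = set0, is_sharp_smfw Q ss, is_faqw Q f & c < f - ss].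
  (* Chosen so that [N > 2 * c + 4], hence [N.+1%:R / 2 - 2 > c]. *)
  pose N := Num.Def.archi_bound `|2 * c + 4|.
  have [_ [ss [f [_ ssP fP _]]]] := widths (biclique_query N).
  exists (biclique_query N), ss, f; split=> //.
  have := biclique_query_gap ssP fP.
  have := archi_boundP (normr_ge0 (2 * c + 4)); rewrite -/N.
  have -> : N.+1%:R = N%:R + 1 :> R by rewrite natr1.
  by have := ler_norm (2 * c + 4); lra.
split=> // [Q F0|c|c].
- by have [s [ss [f [sP ssP fP le]]]] := widths Q; exists s, ss, f; split.
- by have [Q [ss [f [_ ssP fP lt]]]] := gap c; exists Q, ss, f.
- by have [Q [ss [f [F0 ssP fP lt]]]] := gap c; exists Q, ss, f; split.
Qed.
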